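(* Let $p$ be an odd prime and let $A$ be the ring of degree zero stable operations in $p$-local complex $K$-theory (described in the context). An $A$-module $M$ is discrete if and only if it is locally finitely generated, i.e. if and only if for every $x\in M$ the submodule $Ax$ is finitely generated over $\mathbb{Z}_{(p)}$.
   Context: $\mathbb{Z}_{(p)}$ denotes the integers localized at $p$. Let $A=K^0_{(p)}(K_{(p)})$ be the ring of degree zero stable operations in $p$-local complex $K$-theory. Fix an integer $q$ primitive modulo $p^2$ and let $\Psi^q\in A$ be the Adams operation. Put $q_i=q^{(-1)^i\lfloor i/2\rfloor}$ for $i\ge1$, $\Theta_n(X)=\prod_{i=1}^n(X-q_i)\in\mathbb{Z}_{(p)}[X]$, and $\Phi_n=\Theta_n(\Psi^q)\in A$ ($\Phi_0=1$). Every element of $A$ can be written uniquely as a convergent infinite sum $\sum_{n\ge0}a_n\Phi_n$ with $a_n\in\mathbb{Z}_{(p)}$. For $m\ge0$ let $A_m=\{\sum_{n\ge m}a_n\Phi_n : a_n\in\mathbb{Z}_{(p)}\}$, a decreasing chain of ideals; $A$ is given the topology whose open sets are unions of cosets $y+A_m$. An $A$-module $M$ is called discrete if the action map $A\times M\to M$ is continuous for the discrete topology on $M$ and the product topology on $A\times M$; equivalently, for each $x\in M$ there is $n$ with $A_nx=0$. *)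

(* Defs.v *)
From mathcomp Require Import all_boot all_order all_algebra.
Set Implicit Arguments. Unset Strict Implicit. Unset Printing Implicit Defensive.
Import Order.TTheory GRing.Theory Num.Theory.
Local Open Scope ring_scope.

Definition Zloc (p : nat) (r : rat) : bool := ~~ (p%:Z %| denq r)%Z.

Definition primitive_root_mod (m : nat) (q : int) : Prop :=
  coprimez q m%:Z /\
  forall k : nat, (0 < k < totient m)%N -> ~~ (m%:Z %| q ^+ k - 1)%Z.

Definition qi (q : int) (i : nat) : rat :=
  if odd i then (q%:~R : rat) ^- (i./2) else (q%:~R : rat) ^+ (i./2).

Definition Theta (q : int) (n : nat) : {poly rat} :=
  \prod_(1 <= i < n.+1) ('X - (qi q i)%:P).

(* The ring A = K^0_(p)(K_(p)) modelled as the inverse limit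
   lim_n Z_(p)[X]/(Theta_n(X)), with Psi^q |-> X.  An element is a compatible
   family (x n)_n, where x n is the reduced representative (size <= n) of the
   image of the element in Z_(p)[X]/(Theta_n). *)
Definition carrierA := nat -> {poly rat}.

Definition isA (p : nat) (q : int) (x : carrierA) : Prop :=
  forall n : nat,
    x n \is a polyOver (Zloc p) /\ (size (x n) <= n)%N /\
    x n.+1 %% Theta q n = x n.

Definition addA (x y : carrierA) : carrierA := fun n => x n + y n.
Definition mulA (q : int) (x y : carrierA) : carrierA :=
  fun n => (x n * y n) %% Theta q n.
Definition constA (q : int) (r : rat) : carrierA := fun n => r%:P %% Theta q n.
Definition oneA (q : int) : carrierA := constA q 1.

(* membership in the ideal A_m = { sum_{n >= m} a_n Phi_n } *)
Definition inAm (p : nat) (q : int) (m : nat) (x : carrierA) : Prop :=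
  isA p q x /\ x m = 0.

Record is_Amodule (p : nat) (q : int) (M : zmodType)
    (act : carrierA -> M -> M) : Prop := {
  act_addl : forall a b m, isA p q a -> isA p q b ->
    act (addA a b) m = act a m + act b m;
  act_addr : forall a m m', isA p q a -> act a (m + m') = act a m + act a m';
  act_mul : forall a b m, isA p q a -> isA p q b ->
    act (mulA q a b) m = act a (act b m);
  act_one : forall m, act (oneA q) m = m
}.

Definition discrete_mod (p : nat) (q : int) (M : zmodType)
    (act : carrierA -> M -> M) : Prop :=
  forall x : M, exists n : nat, forall a, inAm p q n a -> act a x = 0.

Definition loc_fin_gen (p : nat) (q : int) (M : zmodType)
    (act : carrierA -> M -> M) : Prop :=
  forall x : M, exists gens : seq M,
    (forall g, g \in gens -> exists a, isA p q a /\ g = act a x) /\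
    (forall a, isA p q a -> exists r : nat -> rat,
        (forall i, Zloc p (r i)) /\
        act a x = \sum_(i < size gens) act (constA q (r i)) gens`_i).

(* Main.v *)
(** Discrete implies locally finitely generated because A / A_n is spanned over
    Z_(p) by the powers of Psi^q.

    Conversely let Ax be finitely generated over Z_(p), hence countable.  A is
    complete for the filtration (A_n), and the fibres of a |-> a x are countably
    many, so a Baire argument gives n with A_n x = A_m x for all m >= n; put
    D = A_n x, again finitely generated over the noetherian ring Z_(p).  Modulo p
    the sequence q_i is periodic of period L = 2 (p - 1), so
    Theta_(j+L) = Theta_j (Theta_L + p H_j) with H_j integral.  This gives
    A_(n+L) <= Theta_L A_n + p A_n, and hence D = (Theta_L, p) D.  All the values
    Theta_L(q_i) are divisible by p, so 1 - (b Theta_L + c p) takes values prime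
    to p at every q_i, which makes it a unit of A.  Thus (Theta_L, p) lies in the
    Jacobson radical of A, and Nakayama's lemma gives D = 0. *)

From HB Require Import structures.
From mathcomp Require Import all_boot all_order all_algebra.
From mathcomp Require Import boolp ring.
Require Import Defs.
Set Implicit Arguments. Unset Strict Implicit. Unset Printing Implicit Defensive.
Import Order.TTheory GRing.Theory Num.Theory.
Local Open Scope ring_scope.

(** * Remainders of polynomials over a subring *)

(** Long division by a monic polynomial never inverts a coefficient. The induction follows Horner's
    scheme: after reducing [a], a single subtraction of a scalar multiple of [d] reduces [r]. *)
Lemma polyOver_modp (F : fieldType) (S : subringClosed F) (d a : {poly F}) :
  d \is monic -> d \is a polyOver S -> a \is a polyOver S ->
  a %% d \is a polyOver S.
Proof.
move=> dm dS; elim/poly_ind: a => [|a c IHa]; first by rewrite mod0p rpred0.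
move=> aS.
have [a0S cS] : a \is a polyOver S /\ c \in S.
  split; last by move/polyOverP/(_ 0%N): aS; rewrite coefD coefMX coefC add0r.
  apply/polyOverP => i; move/polyOverP/(_ i.+1): aS.
  by rewrite coefD coefMX coefC addr0.
set r := a %% d * 'X + c%:P.
have rS : r \is a polyOver S by rewrite rpredD ?rpredM ?polyOverX ?polyOverC ?IHa.
have -> : (a * 'X + c%:P) %% d = r %% d.
  by rewrite /r !modpD [_ %% d * 'X]mulrC modp_mul ['X * a]mulrC.
set k := (size d).-1; have sd : size d = k.+1.
  by rewrite prednK // size_poly_gt0 monic_neq0.
have szr : (size r <= size d)%N.
  rewrite (leq_trans (size_polyD _ _)) // geq_max.
  rewrite (leq_trans (size_polyC_leq1 _)) ?sd // andbT.
  rewrite (leq_trans (size_polyMleq _ _)) // size_polyX addn2 /=.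
  by rewrite -sd ltn_modp monic_neq0.
have <- : r - r`_k *: d = r %% d.
  apply: (@modpP _ _ (r`_k)%:P); first by rewrite mul_polyC addrC subrK.
  rewrite sd ltnS; apply/leq_sizeP => j; rewrite leq_eqVlt => /orP[/eqP<-|kj].
    have: d`_k = 1 by move/monicP: dm.
    by rewrite coefB coefZ => ->; rewrite mulr1 subrr.
  have dj : d`_j = 0 by rewrite nth_default // sd.
  have rj : r`_j = 0 by rewrite nth_default // (leq_trans szr) // sd.
  by rewrite coefB coefZ dj rj mulr0 subrr.
rewrite rpredB // polyOverZ //; exact: (polyOverP rS).
Qed.

Lemma modp_dvd_modp (F : fieldType) (d e a : {poly F}) :
  d %| e -> (a %% e) %% d = a %% d.
Proof.
move=> de; rewrite {2}(divp_eq a e) modpD.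
by rewrite [in X in X + _]modp_eq0 ?add0r // dvdp_mull.
Qed.

Lemma eq_modp (F : fieldType) (d a b : {poly F}) :
  (a %% d == b %% d) = (d %| a - b).
Proof. by rewrite -subr_eq0 -modpN -modpD. Qed.

Section OperationRing.

Variables (p : nat) (hp : prime p).

(** * Arithmetic of the discrete valuation ring Z_(p) *)

(** Fractions need not be in lowest terms here, which suits the closure proofs. The reduced
    denominator divides any other denominator, so p cannot divide it. *)
Lemma ZlocP r :
  reflect (exists n d : int, ~~ (p%:Z %| d)%Z /\ r = n%:~R / d%:~R) (Zloc p r).
Proof.
apply: (iffP idP) => [pr|[n [d [pd ->]]]].
  by exists (numq r), (denq r); rewrite divq_num_den.
apply: contra pd => pden; apply: (dvdz_trans pden).
have [->|d0] := eqVneq d 0; first by rewrite dvdz0.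
set r1 := n%:~R / _.
have e : numq r1 * d = n * denq r1.
  apply: (@intr_inj rat); rewrite !rmorphM /=.
  have dr : (denq r1)%:~R != 0 :> rat by rewrite intr_eq0 denq_neq0.
  have dd : d%:~R != 0 :> rat by rewrite intr_eq0.
  apply: (mulIf (invr_neq0 dr)); rewrite mulfK //.
  by rewrite mulrAC divq_num_den /r1 divfK.
rewrite -(@Gauss_dvdzr _ (numq r1)); last first.
  by move: (coprime_num_den r1); rewrite /coprimez /gcdz gcdnC => /eqP ->.
by rewrite e dvdz_mull.
Qed.

Lemma p_dvdzM a b : (p%:Z %| a * b)%Z = (p%:Z %| a)%Z || (p%:Z %| b)%Z.
Proof. by rewrite !dvdzE abszM /= Euclid_dvdM. Qed.

Lemma Zloc_int (n : int) : n%:~R \in Zloc p.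
Proof.
apply/ZlocP; exists n, 1; rewrite divr1; split=> //.
by rewrite dvdzE dvdn1 neq_ltn prime_gt1 ?orbT.
Qed.

Lemma Zloc_nat (n : nat) : n%:R \in Zloc p.
Proof. exact: (Zloc_int n). Qed.

Lemma ndvdp_neq0 (d : int) : ~~ (p%:Z %| d)%Z -> d%:~R != 0 :> rat.
Proof. by apply: contra; rewrite intr_eq0 => /eqP->; rewrite dvdz0. Qed.

Lemma Zloc_subring : GRing.subring_closed (Zloc p).
Proof.
split; first exact: (Zloc_int 1).
  move=> _ _ /ZlocP[a [b [pb ->]]] /ZlocP[c [d [pd ->]]].
  apply/ZlocP; exists (a * d - c * b), (b * d).
  split; first by rewrite p_dvdzM negb_or pb.
  move: (ndvdp_neq0 pb) (ndvdp_neq0 pd) => b0 d0.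
  by field; rewrite b0 d0.
move=> _ _ /ZlocP[a [b [pb ->]]] /ZlocP[c [d [pd ->]]].
apply/ZlocP; exists (a * c), (b * d).
split; first by rewrite p_dvdzM negb_or pb.
move: (ndvdp_neq0 pb) (ndvdp_neq0 pd) => b0 d0.
by field; rewrite b0 d0.
Qed.

HB.instance Definition _ :=
  GRing.isSubringClosed.Build rat (Zloc p) Zloc_subring.

Lemma Zloc_inv_int (n : int) : ~~ (p%:Z %| n)%Z -> (n%:~R)^-1 \in Zloc p.
Proof. by move=> pn; apply/ZlocP; exists 1, n; rewrite mul1r. Qed.

Lemma Zloc_unit t : t \in Zloc p ->
  1 - p%:R * t != 0 /\ (1 - p%:R * t)^-1 \in Zloc p.
Proof.
case/ZlocP=> a [b [pb ->]]; have b0 := ndvdp_neq0 pb.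
have pc : ~~ (p%:Z %| b - p%:Z * a)%Z by rewrite rpredBr // dvdz_mulr.
have c0 := ndvdp_neq0 pc.
have -> : 1 - p%:R * (a%:~R / b%:~R) = (b - p%:Z * a)%:~R / b%:~R :> rat.
  by rewrite rmorphB rmorphM /=; field.
split; first by rewrite mulf_neq0 ?invr_neq0.
by rewrite invf_div; apply/ZlocP; exists b, (b - p%:Z * a).
Qed.

(** This is the valuation ring property: p cannot divide both the reduced numerator and the reduced
    denominator. *)
Lemma Zloc_total r : r != 0 ->
  r \in Zloc p \/ exists2 t, t \in Zloc p & r^-1 = p%:R * t.
Proof.
move=> r0; have [rZ|] := boolP (r \in Zloc p); first by left.
rewrite unfold_in negbK => pd; right.
have pn : ~~ (p%:Z %| numq r)%Z.
  apply/negP => pn; have := coprime_num_den r; rewrite /coprime => /eqP g.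
  have : (p %| gcdn `|numq r| `|denq r|)%N by rewrite dvdn_gcd; apply/andP; split.
  by rewrite g dvdn1 gtn_eqF ?prime_gt1.
case/dvdzP: pd => k e; exists (k%:~R / (numq r)%:~R).
  by apply/ZlocP; exists k, (numq r).
rewrite -[in LHS](divq_num_den r) invf_div e rmorphM /=.
by rewrite mulrCA mulrA.
Qed.

(** Splitting the p-part off the numerator writes [c] as a unit times a power of p. *)
Lemma Zloc_dvd_exp c : c \in Zloc p -> c != 0 ->
  exists2 t, t \in Zloc p & exists k, p%:R ^+ k = c * t.
Proof.
move=> /ZlocP[a [b [pb ->]]] c0; have b0 := ndvdp_neq0 pb.
have a0 : a != 0 by apply: contraNneq c0 => ->; rewrite mul0r.
have a_gt0 : (0 < `|a|)%N by rewrite absz_gt0.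
have [m cpm em] := pfactor_coprime hp a_gt0.
have pm : ~~ (p%:Z %| m%:Z)%Z by rewrite /dvdz /= -prime_coprime.
have m0 := ndvdp_neq0 pm.
set k := logn p _ in em.
exists ((sgz a * b)%:~R / m%:~R); first by apply/ZlocP; exists (sgz a * b), m.
have sa : (sgz a)%:~R * (sgz a)%:~R = 1 :> rat.
  by rewrite -rmorphM /= -expr2 sqr_sg a0.
have ea : a%:~R = (sgz a)%:~R * (m%:~R * p%:R ^+ k) :> rat.
  by rewrite {1}(intEsg a) em PoszM !rmorphM /= -natrX.
exists k; rewrite ea rmorphM /=.
transitivity ((sgz a)%:~R * (sgz a)%:~R * p%:R ^+ k : rat).
  by rewrite sa mul1r.
by field; rewrite m0 b0.
Qed.

(** A nonzero ideal contains a power of p, and the least such power generates it. *)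
Lemma Zloc_ideal_principal (J : rat -> Prop) :
  J 0 -> (forall c, J c -> c \in Zloc p) ->
  (forall c t, J c -> t \in Zloc p -> J (c * t)) ->
  exists2 c, J c & forall c', J c' -> exists2 t, t \in Zloc p & c' = t * c.
Proof.
move=> J0 JZ JM.
have [[c0 Jc0 nz]|J1] := pselect (exists2 c, J c & c != 0); last first.
  exists 0 => // c' Jc'; exists 0; rewrite ?rpred0 // mulr0.
  by apply: contrapT => /eqP nz; apply: J1; exists c'.
have [t tZ [k ek]] := Zloc_dvd_exp (JZ _ Jc0) nz.
have ex : exists n, `[< J (p%:R ^+ n) >].
  by exists k; apply/asboolP; rewrite ek; apply: JM.
case: (ex_minnP ex) => n /asboolP Jn min_n; exists (p%:R ^+ n) => // c Jc.
have p0 : p%:R != 0 :> rat by rewrite pnatr_eq0 -lt0n prime_gt0.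
have [->|c_n0] := eqVneq c 0; first by exists 0; rewrite ?rpred0 ?mul0r.
have r0 : c / p%:R ^+ n != 0 by rewrite mulf_neq0 // invr_neq0 // expf_neq0.
case: (Zloc_total r0) => [rZ|[s sZ es]].
  by exists (c / p%:R ^+ n); rewrite // divfK ?expf_neq0.
case: n Jn min_n r0 es => [|n] Jn min_n r0 es.
  by exists c; [exact: JZ | rewrite mulr1].
(* A quotient [c / p^(n+1)] outside Z_(p) would put [p^n] into [J], against the minimality of
   [n.+1]. *)
suff /asboolP/min_n : J (p%:R ^+ n) by rewrite ltnn.
suff -> : p%:R ^+ n = c * s by apply: JM.
have : p%:R ^+ n.+1 = c * (p%:R * s) by rewrite -es invf_div mulrCA divff ?mulr1.
by rewrite exprS mulrCA => /(mulfI p0).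
Qed.

(** * The sequence q_i and the polynomials Theta_n modulo p *)

Variables (q : int) (pq : ~~ (p%:Z %| q)%Z).

Let q0 : q%:~R != 0 :> rat. Proof. exact: ndvdp_neq0. Qed.

Lemma qi_Zloc i : qi q i \in Zloc p.
Proof.
rewrite /qi; case: ifP => _; last by rewrite rpredX // Zloc_int.
by rewrite -exprVn rpredX // Zloc_inv_int.
Qed.

Lemma fermat_int : (p%:Z %| q ^+ p.-1 - 1)%Z.
Proof.
set a := `|(q %% p)%Z|%N.
have p0 : p%:Z != 0 by rewrite -lt0n prime_gt0.
have qa : (q = a%:Z %[mod p])%Z by rewrite gez0_abs ?modz_ge0 // modz_mod.
have qpa : (q ^+ p = (a ^ p)%N%:Z %[mod p])%Z.
  by rewrite -modzXm qa modzXm; congr (modz _ _); rewrite -!natz natrX.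
have : (q ^+ p = q %[mod p])%Z.
  by rewrite qpa qa !modz_nat fermat_little.
move/eqP; rewrite eqz_mod_dvd -{1}(prednK (prime_gt0 hp)) exprS.
have -> : q * q ^+ p.-1 - q = q * (q ^+ p.-1 - 1) by rewrite mulrBr mulr1.
by rewrite p_dvdzM (negPf pq).
Qed.

(** Shifting an index by [L] keeps its parity and moves [i./2] by p - 1, so Fermat's little theorem
    makes q_i periodic modulo p. *)
Let L := (p.-1).*2.

Lemma qi_period i : exists2 t, t \in Zloc p & qi q (i + L) = qi q i + p%:R * t.
Proof.
have [k ek] := dvdzP fermat_int.
have eq1 : (q%:~R : rat) ^+ p.-1 = 1 + p%:R * k%:~R.
  by rewrite -rmorphXn /= -[q ^+ _](subrK 1) ek rmorphD rmorphM /= addrC mulrC.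
rewrite /qi /L oddD odd_double addbF halfD odd_double andbF add0n doubleK.
case: ifP => _; last first.
  exists (q%:~R ^+ i./2 * k%:~R); first by rewrite rpredM ?rpredX ?Zloc_int.
  by rewrite exprD eq1; ring.
exists (- k%:~R * (q%:~R ^- (i./2 + p.-1))).
  by rewrite rpredM ?rpredN ?Zloc_int // -exprVn rpredX ?Zloc_inv_int.
have -> : p%:R * (- k%:~R * q%:~R ^- (i./2 + p.-1)) =
   (1 - q%:~R ^+ p.-1) * q%:~R ^- (i./2 + p.-1) :> rat.
  by rewrite eq1; ring.
rewrite exprD invfM mulrBl mul1r [X in _ - X]mulrCA divff ?expf_neq0 // mulr1.
by rewrite addrC subrK.
Qed.

Lemma Theta0 : Theta q 0 = 1.
Proof. by rewrite /Theta big_nil. Qed.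

Lemma ThetaS n : Theta q n.+1 = Theta q n * ('X - (qi q n.+1)%:P).
Proof. by rewrite /Theta big_nat_recr. Qed.

Lemma Theta_monic n : Theta q n \is monic.
Proof. by rewrite /Theta monic_prod // => i _; rewrite monicXsubC. Qed.

Lemma Theta_neq0 n : Theta q n != 0.
Proof. exact/monic_neq0/Theta_monic. Qed.

Lemma size_Theta n : size (Theta q n) = n.+1.
Proof.
elim: n => [|n IHn]; first by rewrite Theta0 size_poly1.
by rewrite ThetaS size_Mmonic ?Theta_neq0 ?monicXsubC // IHn size_XsubC addn2.
Qed.

Lemma XsubqiZ i : 'X - (qi q i)%:P \is a polyOver (Zloc p).
Proof. by rewrite rpredB ?polyOverX ?polyOverC ?qi_Zloc. Qed.

Lemma Theta_Zloc n : Theta q n \is a polyOver (Zloc p).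
Proof. by apply: rpred_prod => i _; apply: XsubqiZ. Qed.

Lemma dvdp_Theta m n : (m <= n)%N -> Theta q m %| Theta q n.
Proof.
move=> /subnK <-; elim: (n - m)%N => [|k IHk] //.
by rewrite addSn ThetaS dvdp_mulr.
Qed.

Lemma root_Theta i n : (0 < i <= n)%N -> (Theta q n).[qi q i] = 0.
Proof.
case: i => // i /= /dvdp_Theta/dvdpP[r ->].
by rewrite ThetaS !hornerM hornerXsubC subrr !mulr0.
Qed.

(* The last L factors of Theta_(j+L) run over a full period, and sliding this
   window by one step replaces a factor by a congruent one. *)
Lemma Theta_shift j : exists H, H \is a polyOver (Zloc p) /\
  Theta q (j + L) = Theta q j * (Theta q L + p%:R *: H).
Proof.
have L0 : (0 < L)%N by rewrite double_gt0 -subn1 subn_gt0 prime_gt1.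
pose W j := \prod_(j.+1 <= i < (j + L).+1) ('X - (qi q i)%:P).
have TW k : Theta q (k + L) = Theta q k * W k.
  by rewrite /Theta /W (@big_cat_nat _ _ _ k.+1) //= ltnS leq_addr.
suff [H [HZ eH]] : exists H, H \is a polyOver (Zloc p) /\
    W j = Theta q L + p%:R *: H by exists H; rewrite // TW eH.
elim: j => [|j [H [HZ eH]]].
  exists 0; rewrite rpred0 scaler0 addr0.
  by move: (TW 0%N); rewrite Theta0 mul1r add0n.
have [t tZ et] := qi_period j.+1.
pose Q := \prod_(j.+2 <= i < (j + L).+1) ('X - (qi q i)%:P).
have QZ : Q \is a polyOver (Zloc p) by apply: rpred_prod => i _; apply: XsubqiZ.
have e1 : W j = ('X - (qi q j.+1)%:P) * Q.
  by rewrite /W big_ltn // ltnS -addn1 leq_add2l.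
have e2 : W j.+1 = Q * ('X - (qi q (j.+1 + L))%:P).
  by rewrite /W addSn big_nat_recr //= ltnS -addn1 leq_add2l.
exists (H - t *: Q); split; first by rewrite rpredB // polyOverZ.
rewrite scalerBr addrA -eH e1 e2 et mulrC polyCD opprD addrA mulrDl; congr +%R.
by rewrite scalerA -mul_polyC mulNr.
Qed.

(** A window of [L] consecutive factors can be chosen to contain X - q_i. By [Theta_shift] it is
    congruent to Theta_L modulo p, and it vanishes at q_i. *)
Lemma Theta_period_root i : (0 < i)%N ->
  exists2 t, t \in Zloc p & (Theta q L).[qi q i] = p%:R * t.
Proof.
have L0 : (0 < L)%N by rewrite double_gt0 -subn1 subn_gt0 prime_gt1.
case: i => // i _; have [H [HZ eH]] := Theta_shift i.
have [r er] : exists r, Theta q L + p%:R *: H = ('X - (qi q i.+1)%:P) * r.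
  have : Theta q i.+1 %| Theta q (i + L) by rewrite dvdp_Theta // -addn1 leq_add2l.
  rewrite eH ThetaS dvdp_mul2l ?Theta_neq0 // => /dvdpP[r ->].
  by exists r; rewrite mulrC.
exists (- H.[qi q i.+1]); first by rewrite rpredN rpred_horner ?qi_Zloc.
move/(congr1 (horner^~ (qi q i.+1))): er; rewrite !hornerE subrr mul0r => /eqP.
by rewrite addr_eq0 mulrN => /eqP.
Qed.

(** * Ring structure and filtration of A *)

(** This is the operation P(Psi^q). *)
Definition polyA (P : {poly rat}) : carrierA := fun n => P %% Theta q n.
Definition oppA (a : carrierA) : carrierA := fun n => - a n.

Local Notation isA := (isA p q).
Local Notation inAm := (inAm p q).

Lemma size_modTheta (P : {poly rat}) n : (size (P %% Theta q n)%R <= n)%N.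
Proof. by rewrite -ltnS -(size_Theta n) ltn_modp Theta_neq0. Qed.

Lemma modThetaZ (P : {poly rat}) n : P \is a polyOver (Zloc p) ->
  P %% Theta q n \is a polyOver (Zloc p).
Proof. exact: polyOver_modp (Theta_monic n) (Theta_Zloc n). Qed.

Lemma isA_polyA P : P \is a polyOver (Zloc p) -> isA (polyA P).
Proof.
move=> PZ n; split; first exact: modThetaZ.
by split; [exact: size_modTheta | rewrite modp_dvd_modp // dvdp_Theta].
Qed.

Lemma isA_add a b : isA a -> isA b -> isA (addA a b).
Proof.
move=> aA bA n; have [a1 [a2 a3]] := aA n; have [b1 [b2 b3]] := bA n.
split; first by rewrite rpredD.
split; last by rewrite modpD a3 b3.
by rewrite (leq_trans (size_polyD _ _)) // geq_max a2.
Qed.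

Lemma isA_opp a : isA a -> isA (oppA a).
Proof.
move=> aA n; have [a1 [a2 a3]] := aA n.
by split; [rewrite rpredN | split; [rewrite size_polyN | rewrite modpN a3]].
Qed.

Lemma modp_mulmm (F : fieldType) (d a b : {poly F}) :
  ((a %% d) * (b %% d)) %% d = (a * b) %% d.
Proof. by rewrite modp_mul mulrC modp_mul mulrC. Qed.

Lemma isA_mul a b : isA a -> isA b -> isA (mulA q a b).
Proof.
move=> aA bA n; have [a1 [a2 a3]] := aA n; have [b1 [b2 b3]] := bA n.
split; first by rewrite modThetaZ // rpredM.
split; first exact: size_modTheta.
by rewrite /mulA modp_dvd_modp ?dvdp_Theta // -a3 -b3 modp_mulmm.
Qed.

Lemma isA_Zloc a n : isA a -> a n \is a polyOver (Zloc p).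
Proof. by case/(_ n). Qed.

Lemma isA_small a n : isA a -> a n %% Theta q n = a n.
Proof. by case/(_ n) => _ [sz _]; rewrite modp_small // size_Theta. Qed.

Lemma isA_mod a m n : isA a -> (m <= n)%N -> a n %% Theta q m = a m.
Proof.
move=> aA /subnK <-; elim: (n - m)%N => [|k IHk]; first exact: isA_small.
have [_ [_ e]] := aA (k + m)%N.
by rewrite addSn -IHk -e modp_dvd_modp // dvdp_Theta // leq_addl.
Qed.

Lemma inAm0 a m n : inAm n a -> (m <= n)%N -> a m = 0.
Proof. by case=> aA a0 /(isA_mod aA) <-; rewrite a0 mod0p. Qed.

Lemma inAm_le a m n : inAm n a -> (m <= n)%N -> inAm m a.
Proof. by move=> aAn mn; split; [case: aAn | apply: inAm0 mn]. Qed.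

Lemma inAm_add n a b : inAm n a -> inAm n b -> inAm n (addA a b).
Proof. by case=> aA a0 [bA b0]; split; [exact: isA_add | rewrite /addA a0 b0 addr0]. Qed.

Lemma inAm_opp n a : inAm n a -> inAm n (oppA a).
Proof. by case=> aA a0; split; [exact: isA_opp | rewrite /oppA a0 oppr0]. Qed.

Lemma inAm_mul n a b : isA a -> inAm n b -> inAm n (mulA q a b).
Proof. by move=> aA [bA b0]; split; [exact: isA_mul | rewrite /mulA b0 mulr0 mod0p]. Qed.

Lemma polyAD P Q : polyA (P + Q) = addA (polyA P) (polyA Q).
Proof. by apply: funext => n; rewrite /polyA modpD. Qed.

Lemma polyAM P Q : polyA (P * Q) = mulA q (polyA P) (polyA Q).
Proof. by apply: funext => n; rewrite /mulA /polyA modp_mulmm. Qed.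

Lemma constAD r s : constA q (r + s) = addA (constA q r) (constA q s).
Proof. by apply: funext => n; rewrite /constA polyCD modpD. Qed.

Lemma constAM r s : constA q (r * s) = mulA q (constA q r) (constA q s).
Proof. by apply: funext => n; rewrite /mulA /constA polyCM modp_mulmm. Qed.

Lemma mulA_comm a b : mulA q a b = mulA q b a.
Proof. by apply: funext => n; rewrite /mulA mulrC. Qed.

Lemma isA_const r : r \in Zloc p -> isA (constA q r).
Proof. by move=> rZ; apply: isA_polyA; rewrite polyOverC. Qed.

(** * Convergent series and the expansion in the Phi_n *)

(** Stopping at [n] loses nothing when every [u i] is a multiple of [Theta q i]: the later terms
    vanish modulo [Theta q n]. *)
Definition seriesA (u : nat -> {poly rat}) : carrierA :=
  fun n => (\sum_(0 <= i < n) u i) %% Theta q n.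

Lemma isA_series u :
  (forall i, u i \is a polyOver (Zloc p)) -> (forall i, Theta q i %| u i) ->
  isA (seriesA u).
Proof.
move=> uZ udvd n; split; first by apply: modThetaZ; apply: rpred_sum.
split; first exact: size_modTheta.
rewrite /seriesA modp_dvd_modp ?dvdp_Theta // big_nat_recr //= modpD.
by rewrite (modp_eq0 (udvd n)) addr0.
Qed.

(** The two representatives agree modulo Theta_n and have degree at most n, so they differ by a
    scalar multiple of Theta_n. Since Theta_n is monic, the scalar is the coefficient of X^n; it is
    the a_n of the expansion in the Phi_n. *)
Lemma isA_step a n : isA a -> a n.+1 = a n + (a n.+1)`_n *: Theta q n.
Proof.
move=> aA; have [_ [szn _]] := aA n.+1; have [_ [_ <-]] := aA n.
set c := _`_n; apply/eqP; rewrite -subr_eq; apply/eqP.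
apply: (@modpP _ _ c%:P); first by rewrite mul_polyC addrC subrK.
rewrite size_Theta ltnS; apply/leq_sizeP => j; rewrite coefB coefZ.
rewrite leq_eqVlt => /orP[/eqP<-|nj].
  have := monicP (Theta_monic n); rewrite lead_coefE size_Theta /= => ->.
  by rewrite mulr1 subrr.
have Tj : (Theta q n)`_j = 0 by rewrite nth_default // size_Theta.
have aj : (a n.+1)`_j = 0 by rewrite nth_default // (leq_trans szn).
by rewrite Tj aj mulr0 subrr.
Qed.

Lemma isA_expansion a n : isA a ->
  a n = \sum_(0 <= i < n) (a i.+1)`_i *: Theta q i.
Proof.
move=> aA; elim: n => [|n IHn]; last by rewrite big_nat_recr //= -IHn -isA_step.
by rewrite big_nil -(isA_small 0 aA) Theta0 modp1.
Qed.

(** The expansion of [a] starts at index n + L. Reindexing by j + L and inserting [Theta_shift]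
    splits it into a Theta_L-part and a p-part, each a convergent series starting at index n. *)
Lemma inAm_decomp n a : inAm (n + L) a ->
  exists b c, [/\ inAm n b, inAm n c &
    a = addA (mulA q (polyA (Theta q L)) b) (mulA q (constA q p%:R) c)].
Proof.
move=> aAn; have aA : isA a by case: aAn.
have [H HP] := choice Theta_shift.
pose al i := (a i.+1)`_i.
have alZ i : al i \in Zloc p by exact: (polyOverP (isA_Zloc _ aA)).
have al0 i : (i < n + L)%N -> al i = 0 by move=> ?; rewrite /al (inAm0 aAn) ?coef0.
pose ub j := al (j + L)%N *: Theta q j.
pose uc j := al (j + L)%N *: (Theta q j * H j).
have bA : inAm n (seriesA ub).
  split.
    apply: isA_series => i; first by rewrite polyOverZ ?Theta_Zloc.
    by rewrite /ub -mul_polyC dvdp_mull.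
  rewrite /seriesA big_nat_cond big1 ?mod0p // => i /andP[/andP[_ ni] _].
  by rewrite /ub al0 ?scale0r // ltn_add2r.
have cA : inAm n (seriesA uc).
  split.
    apply: isA_series => i; first by rewrite polyOverZ ?rpredM ?Theta_Zloc ?(HP i).1.
    by rewrite /uc -mul_polyC dvdp_mull // dvdp_mulr.
  rewrite /seriesA big_nat_cond big1 ?mod0p // => i /andP[/andP[_ ni] _].
  by rewrite /uc al0 ?scale0r // ltn_add2r.
exists (seriesA ub), (seriesA uc); split=> //; apply: funext => N.
(* Computing [a N] from [a (N + L)] leaves exactly N terms after the shift of indices. *)
rewrite -(isA_mod aA (leq_addr L N)) isA_expansion // /addA /mulA /constA /polyA.
rewrite /seriesA !modp_mulmm -modpD (@big_cat_nat _ _ _ L) ?leq_addl //=.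
rewrite big_nat_cond big1 ?add0r; last first.
  move=> i /andP[/andP[_ iL] _].
  by rewrite -/(al i) al0 ?scale0r // (leq_trans iL) ?leq_addl.
have -> : \sum_(L <= i < N + L) (a i.+1)`_i *: Theta q i =
    \sum_(0 <= i < N) al (i + L)%N *: Theta q (i + L).
  by rewrite -{1}[L]add0n big_addn addnK.
congr (_ %% _).
rewrite !mulr_sumr -big_split /=; apply: eq_bigr => i _.
rewrite (HP i).2 mulrDr scalerDr; congr (_ + _).
  by rewrite -scalerAr mulrC.
by rewrite /uc mul_polyC -scalerAr scalerA scalerA mulrC.
Qed.

(** * Units of A *)

Lemma mod_Theta_inv n g : g \is a polyOver (Zloc p) ->
  (forall i, (0 < i <= n)%N ->
     g.[qi q i] != 0 /\ (g.[qi q i])^-1 \in Zloc p) ->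
  exists h, h \is a polyOver (Zloc p) /\ Theta q n %| 1 - g * h.
Proof.
move=> gZ; elim: n => [|n IHn] gU.
  by exists 0; rewrite rpred0 Theta0 dvd1p.
have [|h [hZ dh]] := IHn; first by move=> i /andP[i0 ni]; apply: gU; rewrite i0 leqW.
have [c0 cZ] := gU n.+1 (leqnn _); set c := g.[_] in c0 cZ.
(* 1 - g h' = (1 - g h) (1 - g / c), and 1 - g / c vanishes at q_(n+1). *)
exists (h + c^-1 *: (1 - g * h)).
split; first by rewrite rpredD // polyOverZ // rpredB ?rpred1 ?rpredM.
have -> : 1 - g * (h + c^-1 *: (1 - g * h)) = (1 - g * h) * (1 - c^-1 *: g).
  by rewrite -!mul_polyC; ring.
rewrite ThetaS dvdp_mul // dvdp_XsubCl /root !hornerE -/c.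
by rewrite mulVf // subrr.
Qed.

(** The inverses modulo the various Theta_n are compatible because an inverse is unique. *)
Lemma isA_unit_of_values g : isA g ->
  (forall n i, (0 < i <= n)%N ->
     (g n).[qi q i] != 0 /\ ((g n).[qi q i])^-1 \in Zloc p) ->
  exists2 v, isA v & mulA q g v = oneA q.
Proof.
move=> gA gU.
have [h hP] := choice (fun n => mod_Theta_inv (isA_Zloc n gA) (gU n)).
have gh n : (g n * h n) %% Theta q n = 1 %% Theta q n.
  by apply/eqP; rewrite eq_sym eq_modp (hP n).2.
exists (fun n => h n %% Theta q n); last first.
  by apply: funext => n; rewrite /mulA modp_mul gh /oneA /constA.
move=> n; split; first by rewrite modThetaZ ?(hP n).1.
split; first exact: size_modTheta.
rewrite modp_dvd_modp ?dvdp_Theta //.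
have gh' : (g n * h n.+1) %% Theta q n = 1 %% Theta q n.
  have [_ [_ <-]] := gA n.
  rewrite mulrC modp_mul mulrC.
  rewrite -(modp_dvd_modp _ (dvdp_Theta (leqnSn n))) gh.
  by rewrite modp_dvd_modp // dvdp_Theta.
(* Uniqueness of the inverse: modulo Theta_n, h_(n+1) = h_(n+1) g_n h_n = h_n. *)
rewrite -[h n.+1]mulr1 -[LHS]modp_mul -gh modp_mul mulrCA mulrA.
by rewrite mulrC -modp_mul gh' modp_mul mulr1.
Qed.

(** * A-modules and spans of finite families *)

Variables (M : zmodType) (act : carrierA -> M -> M) (hM : is_Amodule p q act).

Lemma actDl a b m : isA a -> isA b -> act (addA a b) m = act a m + act b m.
Proof. exact: (act_addl hM). Qed.

Lemma actDr a m m' : isA a -> act a (m + m') = act a m + act a m'.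
Proof. exact: (act_addr hM). Qed.

Lemma actM a b m : isA a -> isA b -> act (mulA q a b) m = act a (act b m).
Proof. exact: (act_mul hM). Qed.

Lemma act1 m : act (oneA q) m = m.
Proof. exact: (act_one hM). Qed.

Lemma act0l m : act (constA q 0) m = 0.
Proof.
have Z0 : isA (constA q 0) by apply: isA_const; rewrite rpred0.
apply: (addrI (act (constA q 0) m)); rewrite addr0 -actDl //.
by congr act; apply: funext => n; rewrite /addA /constA polyC0 mod0p addr0.
Qed.

Lemma actNl a m : isA a -> act (oppA a) m = - act a m.
Proof.
move=> aA; apply/eqP; rewrite -addr_eq0 -actDl //; last exact: isA_opp.
rewrite -(act0l m); apply/eqP; congr act.
by apply: funext => n; rewrite /addA /oppA /constA addNr polyC0 mod0p.
Qed.

Lemma actr0 a : isA a -> act a 0 = 0.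
Proof. by move=> aA; apply: (addrI (act a 0)); rewrite -actDr // !addr0. Qed.

Lemma actNr a m : isA a -> act a (- m) = - act a m.
Proof.
by move=> aA; apply/eqP; rewrite -addr_eq0 -actDr // addNr actr0.
Qed.

Lemma actBr a m m' : isA a -> act a (m - m') = act a m - act a m'.
Proof. by move=> aA; rewrite actDr // actNr. Qed.

Lemma act_const_subr r s m : r \in Zloc p -> s \in Zloc p ->
  act (constA q (r - s)) m = act (constA q r) m - act (constA q s) m.
Proof.
move=> rZ sZ; have [rA sA] := (isA_const rZ, isA_const sZ).
rewrite -actNl // -actDl //; last exact: isA_opp.
congr act; apply: funext => n.
by rewrite /addA /oppA /constA polyCB modpD modpN.
Qed.

(* [act] is unconstrained outside [isA], hence the first clause. *)
Definition subalgebra (C : carrierA -> Prop) : Prop :=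
  [/\ forall a, C a -> isA a,
      forall r, r \in Zloc p -> C (constA q r),
      forall a b, C a -> C b -> C (addA a b) &
      forall a b, C a -> C b -> C (mulA q a b)].

Definition scalar (a : carrierA) : Prop :=
  exists2 r, r \in Zloc p & a = constA q r.

Lemma subalgebra_scalar : subalgebra scalar.
Proof.
split.
- by move=> _ [r rZ ->]; apply: isA_const.
- by move=> r rZ; exists r.
- move=> _ _ [r rZ ->] [s sZ ->]; exists (r + s); rewrite ?rpredD //.
  by rewrite constAD.
- move=> _ _ [r rZ ->] [s sZ ->]; exists (r * s); rewrite ?rpredM //.
  by rewrite constAM.
Qed.

Lemma subalgebra_full : subalgebra isA.
Proof. by split=> //; [exact: isA_const | exact: isA_add | exact: isA_mul]. Qed.

(** Two choices of [C] matter: the scalars Z_(p) for the noetherian argument, and all of A for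
    Nakayama's lemma. Recursion on the list fits inductions that split off one generator. *)
Fixpoint span (C : carrierA -> Prop) (s : seq M) (y : M) : Prop :=
  if s is g :: s' then exists2 b, C b & span C s' (y - act b g) else y = 0.

Section Span.

Variables (C : carrierA -> Prop) (hC : subalgebra C).

Let CA a : C a -> isA a. Proof. by case: hC => H _ _ _; apply: H. Qed.
Let C_const r : r \in Zloc p -> C (constA q r).
Proof. by case: hC => _ H _ _; apply: H. Qed.

Lemma span_add s y z : span C s y -> span C s z -> span C s (y + z).
Proof.
elim: s y z => [|g s IHs] y z /=; first by move=> -> ->; rewrite addr0.
move=> [b bC yb] [c cC zc]; exists (addA b c); first by case: hC => _ _ H _; apply: H.
by rewrite (actDl _ (CA bC) (CA cC)) opprD addrACA; apply: IHs.
Qed.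

Lemma span_act s a y : C a -> span C s y -> span C s (act a y).
Proof.
move=> aC; elim: s y => [|g s IHs] y /=; first by move=> ->; rewrite (actr0 (CA aC)).
move=> [b bC yb]; exists (mulA q a b); first by case: hC => _ _ _ H; apply: H.
by rewrite (actM _ (CA aC) (CA bC)) -(actBr _ _ (CA aC)); apply: IHs.
Qed.

Lemma span0 s : span C s 0.
Proof.
elim: s => //= g s IHs; exists (constA q 0); first by apply: C_const; rewrite rpred0.
by rewrite act0l subr0.
Qed.

Lemma span_opp s y : span C s y -> span C s (- y).
Proof.
have ZN1 : -1 \in Zloc p by rewrite rpredN rpred1.
have -> : - y = act (constA q (-1)) y.
  rewrite -[-1]sub0r act_const_subr ?rpred0 ?rpred1 // act0l sub0r.
  by rewrite -[in LHS](act1 y).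
by apply: span_act; apply: C_const.
Qed.

Lemma span_sub s y z : span C s y -> span C s z -> span C s (y - z).
Proof. by move=> ys zs; apply: span_add => //; apply: span_opp. Qed.

End Span.

Lemma span_scalar_full s y : span scalar s y -> span isA s y.
Proof.
elim: s y => //= g s IHs y [_ [r rZ ->] ys].
by exists (constA q r); [exact: isA_const | exact: IHs].
Qed.

(** * Noetherianity and Nakayama's lemma *)

(** By induction, the part of [S] inside the span of the tail is finitely generated. One further
    element, whose coefficient at [g] generates a principal ideal, accounts for the rest. *)
Lemma span_noetherian (S : M -> Prop) s :
  S 0 -> (forall y z, S y -> S z -> S (y - z)) ->
  (forall r y, r \in Zloc p -> S y -> S (act (constA q r) y)) ->
  (forall y, S y -> span scalar s y) ->
  exists t, (forall g, g \in t -> S g) /\ (forall y, S y -> span scalar t y).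
Proof.
elim: s S => [|g s IHs] S S0 SB SZ Ss; first by exists [::].
have hC := subalgebra_scalar.
have [||||t [tS St]] := IHs (fun y => S y /\ span scalar s y).
- by split=> //; apply: span0.
- by move=> y z [Sy ys] [Sz zs]; split; [exact: SB | exact: span_sub].
- move=> r y rZ [Sy ys]; split; first exact: SZ.
  by apply: span_act => //; exists r.
- by move=> y [].
(* J is the ideal of the coefficients of g in expressions of elements of S. *)
pose J c := c \in Zloc p /\
  exists2 y, S y & span scalar s (y - act (constA q c) g).
have [|||c [cZ [y0 Sy0 y0s]] Jc] := @Zloc_ideal_principal J.
- by split; rewrite ?rpred0 //; exists 0; rewrite // act0l subr0; apply: span0.
- by move=> c [].
- move=> c t0 [cZ [y Sy ys]] tZ; split; first by rewrite rpredM.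
  exists (act (constA q t0) y); first exact: SZ.
  have [cA tA] := (isA_const cZ, isA_const tZ).
  rewrite mulrC constAM actM // -actBr //.
  by apply: span_act => //; exists t0.
exists (y0 :: t); split.
  by move=> h; rewrite inE => /orP[/eqP->|/tS[]].
move=> y Sy; have [_ [r rZ ->] ys] := Ss y Sy.
have [|e eZ er] := Jc r; first by split=> //; exists y.
exists (constA q e); first by exists e.
apply: St; split; first by apply: SB => //; apply: SZ.
(* As r = e c, the contributions of [g] to y and to e y0 cancel. *)
have -> : y - act (constA q e) y0 = (y - act (constA q r) g)
    - act (constA q e) (y0 - act (constA q c) g).
  have [cA eA] := (isA_const cZ, isA_const eZ).
  rewrite er constAM actM // actBr //.
  by rewrite opprB addrA subrK.
by apply: span_sub => //; apply: span_act => //; exists e.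
Qed.

(** Each value at q_i has the form 1 - p t with t in Z_(p), because p divides Theta_L(q_i); such
    values are units, so [isA_unit_of_values] applies. *)
Lemma unit_radical b c : isA b -> isA c ->
  exists2 v, isA v & mulA q v (addA (oneA q)
    (oppA (addA (mulA q (polyA (Theta q L)) b) (mulA q (constA q p%:R) c))))
    = oneA q.
Proof.
move=> bA cA; set g := addA _ _.
have oneZ : isA (oneA q) by apply: isA_const; rewrite rpred1.
have WA : isA (polyA (Theta q L)) by apply: isA_polyA; exact: Theta_Zloc.
have pA : isA (constA q p%:R) by apply: isA_const; exact: Zloc_nat.
have gA : isA g by apply: isA_add => //; apply: isA_opp; apply: isA_add; apply: isA_mul.
have [|v vA e] := @isA_unit_of_values g gA; last by exists v; rewrite // mulA_comm.
move=> n i /andP[i0 ni].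
(* Reduction modulo Theta_n keeps the value at its root q_i. *)
have hmod P : (P %% Theta q n).[qi q i] = P.[qi q i].
  rewrite {2}(divp_eq P (Theta q n)) hornerD hornerM root_Theta ?i0 //.
  by rewrite mulr0 add0r.
have [t tZ et] := Theta_period_root i0.
have -> : (g n).[qi q i] = 1 - p%:R * (t * (b n).[qi q i] + (c n).[qi q i]).
  rewrite /g /addA /oppA /mulA /oneA /constA /polyA hornerD hornerN hornerD.
  rewrite !hmod !hornerM !hmod !hornerC et; ring.
by apply: Zloc_unit; rewrite rpredD ?rpredM // rpred_horner ?qi_Zloc // isA_Zloc.
Qed.

(** Generators are discarded one at a time: expanding [g] through the radical gives (1 - c) g in the
    span of the others, and 1 - c is a unit. *)
Lemma nakayama (D : M -> Prop) s :
  (forall g, g \in s -> D g) -> (forall y, D y -> span isA s y) ->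
  (forall y, D y -> exists y1 y2, [/\ D y1, D y2 &
     y = act (polyA (Theta q L)) y1 + act (constA q p%:R) y2]) ->
  forall y, D y -> y = 0.
Proof.
have WA : isA (polyA (Theta q L)) by apply: isA_polyA; exact: Theta_Zloc.
have pA : isA (constA q p%:R) by apply: isA_const; exact: Zloc_nat.
have hC := subalgebra_full.
move=> + + Drad; elim: s => [|g s IHs] sD Ds //.
apply: IHs => [h hs|]; first by apply: sD; rewrite inE hs orbT.
suff gs : span isA s g.
  move=> y /Ds[b bA ybs]; rewrite -[y](subrK (act b g)).
  by apply: span_add => //; apply: span_act.
have [y1 [y2 [/Ds[b1 b1A s1] /Ds[b2 b2A s2] eg]]] := Drad g (sD g (mem_head _ _)).
have [v vA ev] := unit_radical b1A b2A.
set c := addA (mulA q _ _) _ in ev.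
have cA : isA c by apply: isA_add; apply: isA_mul.
have oneZ : isA (oneA q) by apply: isA_const; rewrite rpred1.
rewrite -[g]act1 -ev actM //; last by apply: isA_add => //; apply: isA_opp.
apply: span_act => //; rewrite actDl ?actNl //; last exact: isA_opp.
rewrite act1 {1}eg /c actDl ?actM //; try exact: isA_mul.
by rewrite opprD addrACA -!actBr //; apply: span_add => //; apply: span_act.
Qed.

(** * The Baire argument *)

(** If the images A_n x never stabilised, nested cosets avoiding y_0, y_1, ... in turn would shrink
    to an operation whose value at x is missing from the enumeration. *)
Lemma baire_stable (x : M) (y : nat -> M) :
  (forall a, isA a -> exists j, act a x = y j) ->
  exists n, forall m, (n <= m)%N -> forall a, inAm n a ->
    exists2 b, inAm m b & act a x = act b x.
Proof.
move=> surj; apply: contrapT => nstab.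
have jump n : exists m a, [/\ (n <= m)%N, inAm n a &
    forall b, inAm m b -> act a x != act b x].
  apply: contrapT => njump; apply: nstab; exists n => m nm a an.
  apply: contrapT => nb; apply: njump; exists m, a; split=> // b bm.
  by apply/eqP => e; apply: nb; exists b.
(* The j-th state (s, n) stands for the coset s + A_n; passing from u to v at
   stage j shrinks it so as to avoid the fibre over y_j. *)
pose next (u v : carrierA * nat) j := [/\ isA v.1,
  inAm u.2 (addA v.1 (oppA u.1)), (u.2 < v.2)%N &
  forall b, inAm v.2 b -> act (addA v.1 b) x != y j].
have step (w : nat * (carrierA * nat)) :
    exists v, isA w.2.1 -> next w.2 v w.1.
  (* Outside [isA] the unchanged pair serves as a dummy value, making [choice] applicable to all
     states. *)
  case: w => j [s n] /=; have [sA|] := pselect (isA s); last by exists (s, n).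
  (* As a x is not in A_m x, the cosets s + A_m and s + a + A_m have disjoint images, so one of them
     misses y_j. Taking [maxn m n.+1] forces the levels to increase strictly. *)
  have [m [a [nm an am]]] := jump n; have aA : isA a by case: an.
  have [avoid|] := pselect (forall b, inAm m b -> act (addA s b) x != y j).
    exists (s, maxn m n.+1) => _; split=> //=.
    - by split; [apply: isA_add => //; exact: isA_opp | rewrite /addA subrr].
    - by rewrite leq_max ltnSn orbT.
    - by move=> b bm; apply: avoid; apply: inAm_le bm _; rewrite leq_maxl.
  move=> /existsNP[b0 /not_implyP[b0m /negP]]; rewrite negbK => /eqP e0.
  exists (addA s a, maxn m n.+1) => _; split=> /=.
  - exact: isA_add.
  - suff -> : addA (addA s a) (oppA s) = a by [].
    by apply: funext => k; rewrite /addA /oppA addrAC subrr add0r.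
  - by rewrite leq_max ltnSn orbT.
  - move=> b bm; apply/eqP; rewrite -e0 => e.
    have {}bm : inAm m b by apply: inAm_le bm _; rewrite leq_maxl.
    have bA : isA b by case: bm.
    have b0A : isA b0 by case: b0m.
    have db : inAm m (addA b0 (oppA b)) by apply: inAm_add => //; exact: inAm_opp.
    case/eqP: (am _ db); rewrite actDl ?actNl //; last exact: isA_opp.
    move: e; rewrite !actDl //; last exact: isA_add.
    by rewrite -addrA => /addrI <-; rewrite addrK.
have [f fP] := choice step.
pose st := fix st j := if j is k.+1 then f (k, st k) else (constA q 0, 0%N).
have stA j : isA (st j).1.
  elim: j => [|j IHj] /=; first by apply: isA_const; rewrite rpred0.
  by case: (fP (j, st j) IHj).
have stP j : next (st j) (st j.+1) j by exact: (fP (j, st j) (stA j)).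
have st_mono j k : (j <= k)%N -> ((st j).2 + (k - j) <= (st k).2)%N.
  move=> /subnK <-; rewrite addnK; elim: (k - j)%N => [|i IHi]; first by rewrite addn0.
  by rewrite addnS (leq_ltn_trans IHi) //; case: (stP (i + j)%N).
have st_ge j : (j <= (st j).2)%N.
  by apply: leq_trans (st_mono 0%N j isT); rewrite subn0 leq_addl.
have st_eq j k n : (j <= k)%N -> (n <= (st j).2)%N -> (st k).1 n = (st j).1 n.
  move=> /subnK <- nj; elim: (k - j)%N => [|i IHi] //.
  rewrite addSn -IHi; case: (stP (i + j)%N) => _ dA _ _.
  apply/eqP; rewrite -subr_eq0; apply/eqP; apply: (inAm0 dA).
  by apply: leq_trans nj _; apply: leq_trans (st_mono _ _ (leq_addl i j)); rewrite leq_addr.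
(* Stage n has level at least n, so the n-th component no longer changes from there on. *)
pose lim : carrierA := fun n => (st n).1 n.
have limA : isA lim.
  move=> n; have [c1 [c2 c3]] := stA n n.
  split=> //; split=> //; rewrite /lim (isA_mod (stA n.+1) (leqnSn n)).
  exact: st_eq.
have [j ej] := surj lim limA.
have dA : inAm (st j.+1).2 (addA lim (oppA (st j.+1).1)).
  split; first by apply: isA_add => //; apply: isA_opp; exact: (stA j.+1).
  by rewrite /addA /oppA /lim (st_eq _ _ _ (st_ge j.+1)) ?subrr.
(* The limit lies in the coset of stage j + 1, which was chosen to avoid y_j. *)
have [_ _ _ /(_ _ dA)] := stP j.
have -> : addA (st j.+1).1 (addA lim (oppA (st j.+1).1)) = lim.
  by apply: funext => n; rewrite /addA /oppA addrCA subrr addr0.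
by rewrite ej eqxx.
Qed.

(** * The two implications *)

Lemma loc_fin_gen_discrete : loc_fin_gen p q act -> discrete_mod p q act.
Proof.
move=> lfg x; have [gens [_ gensP]] := lfg x.
have hspan a : isA a -> span scalar gens (act a x).
  move=> /gensP[r [rZ ->]]; elim: gens r rZ {gensP} => [|g s IHs] r rZ /=.
    by rewrite big_ord0.
  exists (constA q (r 0%N)); first by exists (r 0%N); rewrite // -topredE /= rZ.
  by rewrite big_ord_recl /= addrC addKr; apply: (IHs (fun i => r i.+1)).
(* Lists of rationals are countable, so [ev] enumerates all Z_(p)-combinations of the generators;
   codes that decode to nothing fall back on the empty list. *)
pose ev (l : seq rat) : M :=
  \sum_(i < size gens) act (constA q l`_i) gens`_i.
have [|n nP] := @baire_stable x (fun j => ev (odflt [::] (unpickle j))).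
  move=> a /gensP[r [rZ ->]]; exists (pickle (mkseq r (size gens))).
  by rewrite pickleK /=; apply: eq_bigr => i _; rewrite nth_mkseq.
exists n; pose D y := exists2 a, inAm n a & y = act a x.
suff D0 : forall y, D y -> y = 0 by move=> a an; apply: D0; exists a.
have [||||t [tD Dt]] := @span_noetherian D gens.
- exists (constA q 0); last by rewrite act0l.
  by split; [apply: isA_const; rewrite rpred0 | rewrite /constA polyC0 mod0p].
- move=> _ _ [a an ->] [b bn ->]; exists (addA a (oppA b)).
    by apply: inAm_add => //; exact: inAm_opp.
  by case: an bn => aA _ [bA _]; rewrite actDl ?actNl //; exact: isA_opp.
- move=> r _ rZ [a an ->]; exists (mulA q (constA q r) a).
    by apply: inAm_mul => //; exact: isA_const.
  by case: an => aA _; rewrite actM //; exact: isA_const.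
- by move=> _ [a [aA _] ->]; apply: hspan.
apply: (nakayama tD) => [y /Dt|_ [a an ->]]; first exact: span_scalar_full.
(* Stability trades [a] for an element of A_(n+L) with the same value at x, and that element
   decomposes. *)
have [a' /inAm_decomp[b [c [bn cn ->]]] ->] := nP _ (leq_addr L n) a an.
have [bA _] := bn; have [cA _] := cn.
exists (act b x), (act c x); split; [by exists b | by exists c|].
rewrite actDl ?actM //; try (by apply: isA_mul => //; first
  [exact: isA_polyA (Theta_Zloc _) | exact: isA_const (Zloc_nat _)]).
  exact: isA_const (Zloc_nat _).
exact: isA_polyA (Theta_Zloc _).
Qed.

Lemma act_polyA (c : nat -> rat) n x : (forall i, c i \in Zloc p) ->
  act (polyA (\poly_(i < n) c i)) x =
  \sum_(i < n) act (constA q (c i)) (act (polyA 'X^i) x).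
Proof.
move=> cZ; rewrite poly_def.
have XA i : isA (polyA 'X^i) by apply: isA_polyA; rewrite polyOverXn.
have cXZ i : c i *: 'X^i \is a polyOver (Zloc p) by rewrite polyOverZ ?polyOverXn.
elim: n => [|n IHn]; first by rewrite !big_ord0; exact: act0l.
rewrite !big_ord_recr /= polyAD actDl; last 2 first.
- by apply: isA_polyA; apply: rpred_sum => i _; apply: cXZ.
- exact: isA_polyA.
rewrite IHn -mul_polyC polyAM actM //; exact: isA_const.
Qed.

Lemma discrete_loc_fin_gen : discrete_mod p q act -> loc_fin_gen p q act.
Proof.
move=> disc x; have [n nP] := disc x.
exists (mkseq (fun i => act (polyA 'X^i) x) n); split.
  move=> _ /mapP[i _ ->]; exists (polyA 'X^i); split=> //.
  by apply: isA_polyA; rewrite polyOverXn.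
move=> a aA; have anZ i : (a n)`_i \in Zloc p by exact: (polyOverP (isA_Zloc n aA)).
exists (fun i => (a n)`_i); split=> //; rewrite size_mkseq.
(* The difference of [a] and its polynomial representative lies in A_n, which kills x, so [a] acts
   on x as a polynomial in Psi^q of degree below n. *)
have PA : isA (polyA (a n)) by apply: isA_polyA; exact: isA_Zloc.
have : act (addA a (oppA (polyA (a n)))) x = 0.
  apply: nP; split; first by apply: isA_add => //; exact: isA_opp.
  by rewrite /addA /oppA /polyA isA_small ?subrr.
rewrite actDl ?actNl //; last exact: isA_opp.
move/eqP; rewrite subr_eq0 => /eqP ->.
have {1}-> : a n = \poly_(i < n) (a n)`_i.
  apply/polyP => i; rewrite coef_poly; case: ltnP => // ni.
  by have [_ [sz _]] := aA n; rewrite nth_default // (leq_trans sz).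
by rewrite act_polyA //; apply: eq_bigr => i _; rewrite nth_mkseq.
Qed.

End OperationRing.

Theorem theorem3p2 (p : nat) (q : int) (hp : prime p) (hodd : odd p)
    (hq : primitive_root_mod (p ^ 2) q)
    (M : zmodType) (act : carrierA -> M -> M) (hM : is_Amodule p q act) :
  discrete_mod p q act <-> loc_fin_gen p q act.
Proof.
(* Coprimality of q to p^2 keeps p from dividing q, so the negative powers of q lie in Z_(p). *)
have pq : ~~ (p%:Z %| q)%Z.
  apply/negP => pq; case: hq => + _; rewrite /coprimez => /eqP g.
  have : (p%:Z %| gcdz q (p ^ 2)%N%:Z)%Z.
    by rewrite dvdz_gcd pq -natz natrX natz expr2 dvdz_mulr.
  by rewrite g dvdzE dvdn1 gtn_eqF ?prime_gt1.
split; first exact: discrete_loc_fin_gen.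
exact: loc_fin_gen_discrete.
Qed.
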